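(* Let $A\in\mathbb{R}^{n\times n}$, $B\in\mathbb{R}^{n\times m}$ and $x_0\in\mathbb{R}^n$, and let $\mathcal{D}_N$ be the data set generated by the Fast exploration algorithm applied to the system $x_{k+1}=Ax_k+Bu_k$ with initial condition $x_0$. Then $\mathcal{H}(\mathcal{D}_N)=\mathcal{H}^*(x_0)$ and $|\mathcal{D}_N|=\tilde n+m\le n+m$, where $\tilde n=\dim\mathcal{V}_{\mathrm{exp}}(x_0)$.
   Context: System: $x_{k+1}=Ax_k+Bu_k$, discrete time, with state $x_k\in\mathbb{R}^n$, input $u_k\in\mathbb{R}^m$, $A\in\mathbb{R}^{n\times n}$, $B\in\mathbb{R}^{n\times m}$; $b^{(1)},\dots,b^{(m)}$ are the columns of $B$ and $e_1,\dots,e_m$ the standard unit vectors of $\mathbb{R}^m$. Fast exploration algorithm. Given the initial state $x_0$, put $x_{-1}:=0$, $s:=1$, $k:=0$, $\mathcal{D}_0:=\emptyset$. Repeat: set $u_k:=0$. If $x_k\in\operatorname{span}\{x_{k-1},\dots,x_0,x_{-1}\}$, then: if $s>m$, stop and return $\mathcal{D}_k$; otherwise set $u_k:=e_s$ and increase $s$ by one. Then (if not stopped) let $x_{k+1}:=Ax_k+Bu_k$, $\mathcal{D}_{k+1}:=\mathcal{D}_k\cup\{(x_{k+1},x_k,u_k)\}$, and increase $k$ by one. $N$ denotes the value of $k$ at which the algorithm stops. Set of data consistent parameters. For a data set $\mathcal{D}_N=\{(x_k^+,x_k,u_k)\mid k=0,\dots,N-1\}$, $\mathcal{H}(\mathcal{D}_N)$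 is the set of all $(\hat A,\hat B)\in\mathbb{R}^{n\times n}\times\mathbb{R}^{n\times m}$ with $x_k^+=\hat Ax_k+\hat Bu_k$ for $k=0,\dots,N-1$. Explorable subspace. $\mathcal{V}_{\mathrm{exp}}(x_0)$ is the smallest $A$-invariant subspace of $\mathbb{R}^n$ containing $\{x_0,b^{(1)},\dots,b^{(m)}\}$, i.e. the intersection of all subspaces $\mathcal{V}\subseteq\mathbb{R}^n$ with $A\mathcal{V}\subseteq\mathcal{V}$ and $\{x_0,b^{(1)},\dots,b^{(m)}\}\subseteq\mathcal{V}$. Optimal identifiable set. $\mathcal{H}^*(x_0):=\{(\hat A,\hat B)\in\mathbb{R}^{n\times n}\times\mathbb{R}^{n\times m}\mid \hat Ax+\hat Bu=Ax+Bu\ \text{for all }(x,u)\in\mathcal{V}_{\mathrm{exp}}(x_0)\times\mathbb{R}^m\}$. *)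

(* Defs.v *)
From mathcomp Require Import all_boot all_order all_algebra.
From mathcomp Require Import finmap.
From mathcomp Require Import boolp classical_sets reals.

Set Implicit Arguments.
Unset Strict Implicit.
Unset Printing Implicit Defensive.

Import GRing.Theory.
Local Open Scope ring_scope.

Section VspaceMeet.
Variables (R : realType) (n : nat).

Lemma vspace_meet_exists (F : set {vspace 'cV[R]_n}) :
  exists W : {vspace 'cV[R]_n},
    forall v, v \in W <-> (forall V, F V -> v \in V).
Proof.
pose P d := `[< exists W : {vspace 'cV[R]_n},
  (forall V, F V -> (W <= V)%VS) /\ \dim W = d >].
have exP : exists d, P d.
  by exists 0%N; apply/asboolP; exists 0%VS; split=> [V _|];
    rewrite ?sub0v ?dimv0.
have ubP d : P d -> (d <= \dim {: 'cV[R]_n})%N.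
  by move=> /asboolP[W [_ <-]]; rewrite dimvS ?subvf.
have [d /asboolP[W [WF dW]] dmax] := ex_maxnP exP ubP.
exists W => v; split=> [vW V FV|vF]; first exact: subvP (WF V FV) v vW.
have /dmax : P (\dim (W + <[v]>)).
  apply/asboolP; exists (W + <[v]>)%VS; split=> // V FV.
  by rewrite subv_add WF //= -memvE vF.
rewrite -dW => le_dim.
suff -> : W = (W + <[v]>)%VS by rewrite (subvP (addvSr _ _)) ?memv_line.
by apply/eqP; rewrite eqEdim addvSl.
Qed.

(* The intersection of an arbitrary, possibly infinite, family of subspaces. *)
Definition vspace_meet (F : set {vspace 'cV[R]_n}) : {vspace 'cV[R]_n} :=
  projT1 (cid (vspace_meet_exists F)).

Lemma memv_meet (F : set {vspace 'cV[R]_n}) v :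
  v \in vspace_meet F <-> (forall V, F V -> v \in V).
Proof. exact: projT2 (cid (vspace_meet_exists F)) v. Qed.

End VspaceMeet.

Section FastExploration.
Variables (R : realType) (n m : nat).
Variables (A : 'M[R]_n) (B : 'M[R]_(n, m)) (x0 : 'cV[R]_n).

(* A data point is a triple (x^+, x, u), read as ((x^+, x), u). *)
Definition datum : choiceType := ('cV[R]_n * 'cV[R]_n * 'cV[R]_m)%type.

(* The variables of the algorithm at time k: [cur] is x_k, [past] is
   x_(k-1), ..., x_0, x_(-1), [src] is s and [data] is D_k. *)
Record state := State {
  cur : 'cV[R]_n;
  past : seq 'cV[R]_n;
  src : nat;
  data : {fset datum}
}.

Definition in_past (st : state) : bool := cur st \in <<past st>>%VS.

(* [src] counts from 1, matching e_1, ..., e_m. *)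
Definition unit_input (s : nat) : 'cV[R]_m := \col_(i < m) (i.+1 == s)%:R.

Definition stopping (st : state) : bool := in_past st && (m < src st)%N.

Definition input (st : state) : 'cV[R]_m :=
  if in_past st then unit_input (src st) else 0.

Definition next (st : state) : state :=
  let u := input st in
  let x' := A *m cur st + B *m u in
  {| cur := x';
     past := cur st :: past st;
     src := if in_past st then (src st).+1 else src st;
     data := (data st `|` [fset ((x', cur st, u) : datum)])%fset |}.

Definition initial : state :=
  {| cur := x0; past := [:: 0]; src := 1; data := fset0 |}.

(* Meaningful up to the first time at which [stopping] holds. *)
Definition state_at (k : nat) : state := iter k next initial.

Definition stops_at (N : nat) : Prop :=
  stopping (state_at N) /\ forall k, (k < N)%N -> ~~ stopping (state_at k).

Definition data_at (k : nat) : {fset datum} := data (state_at k).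

Definition consistent (D : {fset datum}) : set ('M[R]_n * 'M[R]_(n, m)) :=
  [set P : 'M[R]_n * 'M[R]_(n, m) |
     forall (xp x : 'cV[R]_n) (u : 'cV[R]_m), ((xp, x, u) : datum) \in D ->
             xp = P.1 *m x + P.2 *m u]%classic.

Definition explorable : {vspace 'cV[R]_n} :=
  vspace_meet
    [set V : {vspace 'cV[R]_n} |
      [/\ forall v : 'cV[R]_n, v \in V -> A *m v \in V,
                 x0 \in V
               & forall j : 'I_m, col j B \in V]]%classic.

Definition optimal_set : set ('M[R]_n * 'M[R]_(n, m)) :=
  [set P : 'M[R]_n * 'M[R]_(n, m) |
     forall (x : 'cV[R]_n) (u : 'cV[R]_m), x \in explorable ->
             P.1 *m x + P.2 *m u = A *m x + B *m u]%classic.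

End FastExploration.

(* Main.v *)
Require Import Defs.
From mathcomp Require Import all_boot all_order all_algebra.
From mathcomp Require Import finmap.
From mathcomp Require Import boolp classical_sets reals.

(** Write X_k for the span of x_(k-1), ..., x_0, x_(-1), and s_k for the value
    of s at time k.  Each step of the algorithm makes exactly one unit of
    progress: either x_k lies outside X_k and the dimension of X_k grows, or
    x_k lies in X_k and the next input direction is used.  Hence
    k + 1 = dim X_k + s_k ([step_count]).  As long as the algorithm has not
    stopped, s_k <= m + 1, so it stops at some N <= n + m, and then
    s_N = m + 1 and N = dim X_N + m.

    Everything about the content of the data rests on one propagation principle
    ([data_determine]): if F x + G u lies in a subspace W for all data
    (x^+, x, u) in D_k, then F maps X_k into W and G maps the inputs
    e_1, ..., e_(s_k - 1) into W.  Indeed, when x_k is new the input is zero and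
    the datum speaks of F x_k alone; when x_k is in X_k, its image F x_k is
    already known to be in W, so the datum isolates G e_(s_k).
    - With (F, G) = (A, B) and W = X_N, which contains all successor states once
      x_N is in X_N, the principle says that X_N is A-invariant and contains the
      columns of B.  Since X_N is reached from x_0, it is the explorable
      subspace.
    - With (F, G) the difference of consistent parameters and the true ones, and
      W = 0, the principle says that the two agree on X_N and on all inputs.

    Finally the N data are pairwise distinct ([data_fresh]), because the new pair
    (x_k, u_k) has either a state outside X_k or an input direction not used
    before; so the data set has N = dim X_N + m elements. *)

Set Implicit Arguments.
Unset Strict Implicit.
Unset Printing Implicit Defensive.

Import GRing.Theory.
Local Open Scope ring_scope.

Lemma dim_span_cons (K : fieldType) (vT : vectType K) (v : vT) (s : seq vT) :
  (\dim <<v :: s>> = (v \notin <<s>>%VS) + \dim <<s>>)%N.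
Proof.
rewrite span_cons; case: (boolP (v \in _)) => [vs|vNs] /=.
  by move: vs; rewrite memvE => /addv_idPr->.
have v0 : v != 0 by apply: contraNneq vNs => ->; exact: mem0v.
rewrite dimv_disjoint_sum ?dim_vline ?v0 //=; apply/eqP; rewrite -subv0.
apply/subvP => w; rewrite memv_cap => /andP[/vlineP[c ->]].
have [->|c0] := eqVneq c 0; first by rewrite scale0r !mem0v.
by rewrite rpredZeq (negPf c0) (negPf vNs).
Qed.

Section UnitInput.
Variables (R : realType) (m : nat).

Lemma unit_input_neq0 s : (0 < s <= m)%N -> unit_input R m s != 0.
Proof.
case: s => // s /= sm; apply/eqP => /matrixP/(_ (Ordinal sm) 0).
by rewrite !mxE eqxx => /eqP; rewrite oner_eq0.
Qed.

Lemma unit_input_inj s t :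
  (0 < s <= m)%N -> unit_input R m s = unit_input R m t -> s = t.
Proof.
case: s => // s /= sm /matrixP/(_ (Ordinal sm) 0); rewrite !mxE eqxx.
by case: eqP => // _ /eqP; rewrite oner_eq0.
Qed.

Lemma mulmx_unit_input p (G : 'M[R]_(p, m)) (j : 'I_m) :
  G *m unit_input R m j.+1 = col j G.
Proof.
by rewrite colE; congr (_ *m _); apply/matrixP => i k; rewrite !mxE ord1 andbT.
Qed.

End UnitInput.

Section Run.
Variables (R : realType) (n m : nat).
Variables (A : 'M[R]_n) (B : 'M[R]_(n, m)) (x0 : 'cV[R]_n).

Let st k := state_at A B x0 k.
Let X k : {vspace 'cV[R]_n} := <<past (st k)>>%VS.

Let stS k : st k.+1 = Defs.next A B (st k).
Proof. by []. Qed.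

Let XS k : X k.+1 = (<[cur (st k)]> + X k)%VS.
Proof. exact: span_cons. Qed.

Lemma step_count k : (k.+1 = \dim (X k) + src (st k))%N.
Proof.
elim: k => [|k IHk].
  by rewrite /X /= span_seq1 dim_vline eqxx.
rewrite /X stS /= dim_span_cons -/(in_past _) -/(X k) [in LHS]IHk.
by case: (in_past _); rewrite /= ?addnS.
Qed.

Lemma src_gt0 k : (0 < src (st k))%N.
Proof. by elim: k => // k IHk; rewrite stS /=; case: ifP. Qed.

Lemma src_le_running k :
  (forall i, (i < k)%N -> ~~ stopping (st i)) -> (src (st k) <= m.+1)%N.
Proof.
elim: k => // k IHk run; rewrite stS /=.
case: ifP => [inp|_]; last by apply: IHk => i ik; apply/run/ltnW.
by have := run k (ltnSn k); rewrite /stopping inp -leqNgt.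
Qed.

(** The counter identity leaves room for at most n + m steps, since dim X_k is
    bounded by n and s_k by m + 1. *)
Lemma stops : exists N, stops_at A B x0 N.
Proof.
have [N stN] : exists N, stopping (st N).
  apply: contrapT => nostop.
  have run k : ~~ stopping (st k) by apply/negP => sk; apply: nostop; exists k.
  have := step_count (n + m).+1.
  have dimX : (\dim (X (n + m).+1) <= n)%N.
    by rewrite (leq_trans (dimvS (subvf _))) // dimvf /dim /= muln1.
  have := leq_add dimX (@src_le_running (n + m).+1 (fun i _ => run i)).
  by move=> /[swap] <-; rewrite addnS ltnn.
have exN : exists N, stopping (st N) by exists N.
case: (ex_minnP exN) => M stM minM; exists M; split=> // k kM.
by apply/negP => /minM; rewrite leqNgt kM.
Qed.

Lemma data_succ k xp x u :
  ((xp, x, u) : datum R n m) \in data (st k) ->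
  [/\ xp = A *m x + B *m u, x \in X k
    & xp \in (<[cur (st k)]> + X k)%VS].
Proof.
elim: k xp x u => [|k IHk] xp x u; first by rewrite in_fset0.
rewrite stS /= in_fsetU in_fset1 XS => /orP[/IHk[-> xX xpX]|/eqP[-> -> ->]].
  split=> //; first exact: (subvP (addvSr _ _)).
  exact: (subvP (addvSr _ _)).
split=> //; first by rewrite (subvP (addvSl _ _)) ?memv_line.
by rewrite (subvP (addvSl _ _)) ?memv_line.
Qed.

Lemma data_input k xp x u :
  ((xp, x, u) : datum R n m) \in data (st k) ->
  u = 0 \/ exists2 j, (j < src (st k))%N & u = unit_input R m j.
Proof.
elim: k => [|k IHk]; first by rewrite in_fset0.
rewrite stS /= in_fsetU in_fset1 => /orP[/IHk[->|[j js ->]]|/eqP[_ _ ->]].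
- by left.
- by right; exists j => //; case: ifP => // _; exact: ltnW.
- by rewrite /input; case: ifP => _; [right; exists (src (st k)) | left].
Qed.

(** Before stopping, an input direction is used only for s_k <= m, so it is
    nonzero and differs from all earlier ones, while a zero input is used only
    when x_k lies outside X_k, which contains the states of all earlier data. *)
Lemma data_fresh k xp :
  ~~ stopping (st k) ->
  ((xp, cur (st k), input (st k)) : datum R n m) \notin data (st k).
Proof.
move=> run; apply/negP => inD; have [_ xX _] := data_succ inD.
have inp : in_past (st k) by [].
have s_m : (0 < src (st k) <= m)%N.
  by rewrite src_gt0 leqNgt; move: run; rewrite /stopping inp.
have [|[j js]] := data_input inD; rewrite /input inp.
  by apply/eqP/unit_input_neq0.
by move=> /(unit_input_inj s_m) sj; rewrite sj ltnn in js.
Qed.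

Lemma card_data_running k :
  (forall i, (i < k)%N -> ~~ stopping (st i)) -> #|` data (st k)| = k.
Proof.
elim: k => [|k IHk] run; first exact: cardfs0.
rewrite stS /= fsetUC cardfsU1 data_fresh ?run //.
by rewrite IHk // => i ik; apply/run/ltnW.
Qed.

(** A linear condition on the pairs (x, u) of the data spreads to all of X_k and
    to all inputs used so far: the data with zero input give the condition on
    new states, and these then give it on the input directions. *)
Lemma data_determine (F : 'M[R]_n) (G : 'M[R]_(n, m))
    (W : {vspace 'cV[R]_n}) k :
  (forall xp x u, ((xp, x, u) : datum R n m) \in data (st k) ->
     F *m x + G *m u \in W) ->
  (forall x, x \in X k -> F *m x \in W) /\
  (forall j, (j < src (st k))%N -> G *m unit_input R m j \in W).
Proof.
elim: k => [|k IHk] FGW.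
  split=> [x|[|//] _].
    rewrite /X /= span_seq1 => /vlineP[c ->].
    by rewrite scaler0 mulmx0 mem0v.
  suff -> : unit_input R m 0 = 0 by rewrite mulmx0 mem0v.
  by apply/matrixP => i j; rewrite !mxE.
have [|FX GE] := IHk.
  by move=> xp x u xD; apply: (FGW xp); rewrite stS /= in_fsetU xD.
have : F *m cur (st k) + G *m input (st k) \in W.
  apply: (FGW (A *m cur (st k) + B *m input (st k))).
  by rewrite stS /= in_fsetU in_fset1 eqxx orbT.
have XSW : F *m cur (st k) \in W -> forall x, x \in X k.+1 -> F *m x \in W.
  move=> Fx x; rewrite XS => /memv_addP[_ /vlineP[c ->] [y yX ->]].
  rewrite mulmxDr -scalemxAr.
  by apply: rpredD; [exact: rpredZ | exact: FX].
rewrite /input stS /=; case: (boolP (in_past _)) => [inp|_].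
  have Fx : F *m cur (st k) \in W by apply: FX.
  rewrite rpredDl // => Gs; split; first exact: XSW.
  by move=> j; rewrite ltnS leq_eqVlt => /orP[/eqP->//|/GE].
by rewrite mulmx0 addr0 => /XSW.
Qed.

Lemma mem_explorable v :
  v \in explorable A B x0 <->
  (forall V : {vspace 'cV[R]_n},
     [/\ forall w, w \in V -> A *m w \in V, x0 \in V
       & forall j, col j B \in V] -> v \in V).
Proof. exact: memv_meet. Qed.

Lemma explorable_closed :
  [/\ forall w, w \in explorable A B x0 -> A *m w \in explorable A B x0,
      x0 \in explorable A B x0 & forall j, col j B \in explorable A B x0].
Proof.
split=> [w /mem_explorable wE|| j]; apply/mem_explorable => V VP.
- by have [AV _ _] := VP; apply/AV/wE.
- by case: VP.
- by case: VP.
Qed.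

Lemma mulmx_explorable u : B *m u \in explorable A B x0.
Proof.
have [_ _ BE] := explorable_closed.
suff -> : B *m u = \sum_j u j 0 *: col j B.
  by apply: memv_suml => j _; exact: memvZ.
apply/matrixP => i k; rewrite !mxE summxE ord1.
by apply: eq_bigr => j _; rewrite !mxE mulrC.
Qed.

Lemma past_explorable k :
  cur (st k) \in explorable A B x0 /\ (X k <= explorable A B x0)%VS.
Proof.
have [AE x0E _] := explorable_closed.
elim: k => [|k [xE XE]]; first by rewrite /X /= span_seq1 -memvE mem0v.
by rewrite XS subv_add -memvE xE XE stS /= memvD ?AE ?mulmx_explorable.
Qed.

Section Stopped.
Variable N : nat.
Hypothesis stopN : stops_at A B x0 N.

Lemma src_stop : src (st N) = m.+1.
Proof.
case: stopN => /andP[_ ltms] run.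
by apply/eqP; rewrite eqn_leq ltms src_le_running.
Qed.

(** Once x_N is in X_N, all successor states of the data are in X_N, so the
    data certify that X_N is A-invariant and contains the columns of B. *)
Lemma past_stop : X N = explorable A B x0.
Proof.
case: (stopN) => /andP[inp _] _.
have XN : (<[cur (st N)]> + X N)%VS = X N by apply/addv_idPr; rewrite -memvE.
have [|AX BX] := @data_determine A B (X N) N.
  by move=> xp x u /data_succ[<- _]; rewrite XN.
apply/eqP; rewrite eqEsubv (past_explorable N).2 /=.
apply/subvP => v /mem_explorable; apply; split=> //.
  (* The span of all states up to x_k is used rather than X_k because x_0 is
     not yet a past state when k = 0. *)
  have x0X k : x0 \in (<[cur (st k)]> + X k)%VS.
    elim: k => [|k IHk]; first by rewrite (subvP (addvSl _ _)) ?memv_line.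
    by rewrite XS (subvP (addvSr _ _)).
  by rewrite -XN.
by move=> j; rewrite -mulmx_unit_input BX // src_stop ltnS.
Qed.

Lemma consistent_stop : consistent (data (st N)) = optimal_set A B x0.
Proof.
apply/seteqP; split=> -[F G] /= FG.
  have [|FX GE] := @data_determine (F - A) (G - B) 0%VS N.
    move=> xp x u xD; have [xpE _ _] := data_succ xD.
    rewrite memv0 !mulmxBl addrACA -opprD -(FG _ _ _ xD) xpE.
    by rewrite subrr.
  have GB : G = B.
    apply/eqP; rewrite -subr_eq0; apply/eqP/matrixP => i j.
    have /GE : (j.+1 < src (st N))%N by rewrite src_stop ltnS.
    rewrite mulmx_unit_input memv0 => /eqP/matrixP/(_ i 0).
    by rewrite !mxE.
  move=> x u; rewrite -past_stop GB => /FX.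
  by rewrite memv0 mulmxBl subr_eq0 => /eqP->.
move=> xp x u /data_succ[-> xX _].
by rewrite FG // -past_stop.
Qed.

Lemma card_data_stop : #|` data (st N)| = (\dim (explorable A B x0) + m)%N.
Proof.
rewrite card_data_running; last by case: stopN.
by apply: succn_inj; rewrite step_count src_stop past_stop addnS.
Qed.

End Stopped.
End Run.

Theorem theorem3 (R : realType) (n m : nat)
    (A : 'M[R]_n) (B : 'M[R]_(n, m)) (x0 : 'cV[R]_n) :
  (exists N : nat, stops_at A B x0 N) /\
  (forall N : nat, stops_at A B x0 N ->
     [/\ consistent (data_at A B x0 N) = optimal_set A B x0,
         #|` data_at A B x0 N| = (\dim (explorable A B x0) + m)%N
       & (\dim (explorable A B x0) + m <= n + m)%N]).
Proof.
split; first exact: stops.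
move=> N stopN; split.
- exact: consistent_stop.
- exact: card_data_stop.
- by rewrite leq_add2r (leq_trans (dimvS (subvf _))) // dimvf /dim /= muln1.
Qed.
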